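(* Let $m$ and $n$ be non-negative integers. Then the set $[1,m]^n$ of words of length $n$ with entries in $\{1,\dots,m\}$ is the disjoint union $$[1,m]^n=\bigsqcup_{0\le k\le \min(m,n)}\ \bigsqcup_{v\in RG(n,k)} [v,\omega_m(v)],$$ where $[v,\omega_m(v)]$ denotes the interval $\{w\in\mathbb{P}^n: v\le w\le \omega_m(v)\}$ in the poset $\mathbb{P}^n$.
   Context: $\mathbb{P}$ denotes the positive integers and $\mathbb{P}^n$ the set of words $w_1w_2\cdots w_n$ of length $n$ with entries in $\mathbb{P}$, partially ordered entrywise: $v_1\cdots v_n\le w_1\cdots w_n$ iff $v_i\le w_i$ for all $i$. For $S\subseteq\mathbb{P}$, $S^*$ denotes the set of all finite words (including the empty word) with entries in $S$, and $[1,i]=\{1,\dots,i\}$. A word $w=w_1\cdots w_n$ of positive integers is an $RG$-word (restricted growth word) if $w_i\le\max(0,w_1,\dots,w_{i-1})+1$ for all $i$; $RG(n,k)$ is the set of $RG$-words of length $n$ with maximal entry $k$ ($RG(0,0)$ consists of the empty word, and $RG(n,0)=\emptyset$ for $n>0$). Every $v\in RG(n,k)$ has a unique factorization $v=1\cdot u_1\cdot 2\cdot u_2\cdots k\cdot u_k$ (concatenation) with $u_i\in[1,i]^*$. For an integer $m\ge k$ define $\omega_m(v)=m\cdot u_1\cdot m\cdot u_2\cdots m\cdot u_k$, i.e. each left-to-right maximum of $v$ is replaced by $m$. *)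

(* Defs.v *)
From HB Require Import structures.
From mathcomp Require Import all_boot all_order.
From mathcomp Require Import boolp classical_sets.

Set Implicit Arguments.
Unset Strict Implicit.
Unset Printing Implicit Defensive.

Import Order.TTheory.
Local Open Scope classical_set_scope.

(* Words of length n live in n.-tupleprod nat, whose canonical order is the
   entrywise (product) order; positivity of the entries is a predicate. *)

Definition posint : set nat := [set x | 0 < x].

Definition segment (m : nat) : set nat := [set x | 1 <= x <= m].

Definition words (S : set nat) (n : nat) : set (n.-tupleprod nat) :=
  [set w | forall i, S (tnth w i)].
Arguments words S n : clear implicits.

Definition word_interval (n : nat) (v z : n.-tupleprod nat) :
    set (n.-tupleprod nat) :=
  [set w | words posint n w /\ (v <= w <= z)%O].

Definition is_RG (n : nat) (w : n.-tupleprod nat) : Prop :=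
  words posint n w /\
  forall i, tnth w i <= (\max_(j < n | j < i) tnth w j) + 1.

(* The empty word has maximal entry 0, see RG00 and RGn0 below. *)
Definition RG (n k : nat) : set (n.-tupleprod nat) :=
  [set w | is_RG w /\ \max_(i < n) tnth w i = k].
Arguments RG n k : clear implicits.

Definition is_lrmax (n : nat) (w : n.-tupleprod nat) (i : 'I_n) : bool :=
  [forall j : 'I_n, (j < i) ==> (tnth w j < tnth w i)].

(* omega_factorization below is the description of omega in terms of the
   factorization 1 u_1 2 u_2 ... k u_k. *)
Definition omega (m n : nat) (v : n.-tupleprod nat) : n.-tupleprod nat :=
  [tuple if is_lrmax v i then m else tnth v i | i < n].

Lemma word_leP (n : nat) (v w : n.-tupleprod nat) :
  reflect (forall i, tnth v i <= tnth w i) (v <= w)%O.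
Proof. by rewrite Order.TupleProdOrder.leEtprod; apply: forallP. Qed.

Lemma RG00 : RG 0 0 = setT.
Proof.
apply/seteqP; split=> // w _; split; last by rewrite big_ord0.
by split; case.
Qed.

Lemma RGn0 (n : nat) : 0 < n -> RG n 0 = set0.
Proof.
case: n => // n _; apply/seteqP; split=> // w [[wpos _] max0].
have := wpos ord0; rewrite /posint /= ltnNge -max0.
by rewrite (leq_bigmax (F := tnth w)).
Qed.

Fixpoint replace_lrmax (m M : nat) (s : seq nat) : seq nat :=
  if s is x :: s' then
    (if M < x then m else x) :: replace_lrmax m (maxn M x) s'
  else [::].

Lemma size_replace_lrmax m M s : size (replace_lrmax m M s) = size s.
Proof. by elim: s M => //= x s IH M; rewrite IH. Qed.

Lemma nth_replace_lrmax m M s i : i < size s ->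
  nth 0 (replace_lrmax m M s) i =
  if (M < nth 0 s i) && all (fun y => y < nth 0 s i) (take i s)
  then m else nth 0 s i.
Proof.
elim: s M i => //= x s IH M [_ | i] /=; first by rewrite andbT.
by rewrite ltnS => /IH->; rewrite gtn_max andbA.
Qed.

Lemma omega_replace_lrmax m n (v : n.-tupleprod nat) :
  words posint n v -> omega m v = replace_lrmax m 0 v :> seq nat.
Proof.
move=> vpos; apply: (@eq_from_nth _ 0).
  by rewrite size_replace_lrmax !size_tuple.
move=> i; rewrite size_tuple => lt_in.
rewrite nth_replace_lrmax ?size_tuple//.
rewrite -(tnth_nth 0 (omega m v) (Ordinal lt_in)) tnth_mktuple.
rewrite -(tnth_nth 0 v (Ordinal lt_in)).
have -> : 0 < tnth v (Ordinal lt_in) by apply: vpos.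
congr (if _ then _ else _) => /=; apply/forallP/(all_nthP 0) => H j.
  rewrite size_take size_tuple lt_in => lt_ji; rewrite nth_take//.
  have lt_jn := ltn_trans lt_ji lt_in.
  by have := implyP (H (Ordinal lt_jn)) lt_ji; rewrite (tnth_nth 0 v (Ordinal lt_jn)).
apply/implyP=> lt_ji; have := H j.
by rewrite size_take size_tuple lt_in nth_take// -tnth_nth; apply.
Qed.

Lemma replace_lrmax_cat m M s t : all (fun x => x <= M) s ->
  replace_lrmax m M (s ++ t) = s ++ replace_lrmax m M t.
Proof.
elim: s => //= x s IH /andP[le_xM /IH IHs].
by rewrite ltnNge le_xM (maxn_idPl le_xM) /= IHs.
Qed.

Lemma omega_factorization (m n : nat) (v : n.-tupleprod nat)
    (u : seq (seq nat)) :
  (forall i, i < size u -> all (fun x => 1 <= x <= i.+1) (nth [::] u i)) ->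
  v = flatten [seq i.+1 :: nth [::] u i | i <- iota 0 (size u)] :> seq nat ->
  omega m v = flatten [seq m :: ui | ui <- u] :> seq nat.
Proof.
move=> u_le def_v; rewrite omega_replace_lrmax; last first.
  move=> i; rewrite /posint /=; have: tnth v i \in (v : seq nat) by apply: mem_tnth.
  rewrite def_v.
  case/flatten_mapP=> j; rewrite mem_iota add0n => /= /u_le/allP uj.
  by rewrite inE => /predU1P[-> // | /uj/andP[]].
rewrite {}def_v; move: u_le.
suff gen M : (forall i, i < size u ->
      all (fun x => 1 <= x <= (M + i).+1) (nth [::] u i)) ->
    replace_lrmax m M
      (flatten [seq (M + i).+1 :: nth [::] u i | i <- iota 0 (size u)]) =
    flatten [seq m :: ui | ui <- u] by exact: (gen 0).
elim: u M => //= u0 u IH M u_le.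
rewrite addn0 ltnS leqnn (maxn_idPr (leqnSn M)) replace_lrmax_cat; last first.
  by apply/allP=> x /(allP (u_le 0 isT)); rewrite addn0 => /andP[].
congr (_ :: _ ++ _); rewrite (iotaDl 1 0) -map_comp.
rewrite -(IH M.+1) => [|i lt_iu]; last by rewrite addSnnS; apply: u_le.
congr (replace_lrmax _ _ (flatten _)).
by apply: eq_map => i /=; rewrite addnS addSn.
Qed.

(* Main.v *)
(* Write M_i for the maximum of the first i letters of v.  If v is an RG-word
   and w lies in [v, omega_m(v)], then v_i = min(w_i, M_i + 1) for all i: at a
   left-to-right maximum v_i = M_i + 1 <= w_i, elsewhere w_i = v_i <= M_i.
   This recurrence determines v from w, whence disjointness; conversely,
   solving it for a word w over [1,m] yields an RG-word whose interval
   contains w. *)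
Require Import Defs.
From HB Require Import structures.
From mathcomp Require Import all_boot all_order.
From mathcomp Require Import boolp classical_sets.

Set Implicit Arguments.
Unset Strict Implicit.
Unset Printing Implicit Defensive.

Import Order.TTheory.
Local Open Scope classical_set_scope.

Definition prefix_max (n : nat) (v : n.-tupleprod nat) (i : nat) : nat :=
  \max_(j < n | j < i) tnth v j.

(** Positivity matters at the first letter, where [is_lrmax] holds vacuously and the empty maximum
    is 0. *)
Lemma is_lrmaxE (n : nat) (v : n.-tupleprod nat) (i : 'I_n) :
  0 < tnth v i -> is_lrmax v i = (prefix_max v i < tnth v i).
Proof.
move=> vi_gt0; apply/forallP/idP => [vi_max | lt_vi j].
  rewrite -(prednK vi_gt0) ltnS; apply/bigmax_leqP => j lt_ji.
  by rewrite -ltnS (prednK vi_gt0) (implyP (vi_max j)).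
apply/implyP=> lt_ji; apply: leq_ltn_trans lt_vi.
exact: (leq_bigmax_cond (F := tnth v)).
Qed.

Lemma RG_interval_rec (m n : nat) (v w : n.-tupleprod nat) :
  is_RG v -> word_interval v (omega m v) w ->
  forall i, tnth v i = minn (tnth w i) (prefix_max v i).+1.
Proof.
case=> vpos vRG [_ /andP[/word_leP le_vw /word_leP le_wo]] i.
have := le_wo i; rewrite tnth_mktuple is_lrmaxE ?vpos//.
have := vRG i; rewrite addn1 -/(prefix_max v i) => le_vi.
case: ltnP => [lt_vi _ | ge_vi le_wv].
  have vi_eq : tnth v i = (prefix_max v i).+1.
    by apply/eqP; rewrite eqn_leq le_vi lt_vi.
  by rewrite -vi_eq; apply/esym/minn_idPr.
have -> : tnth w i = tnth v i by apply/eqP; rewrite eqn_leq le_wv le_vw.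
by apply/esym/minn_idPl; apply: leqW.
Qed.

Lemma minn_rec_inj (n : nat) (w v v' : n.-tupleprod nat) :
  (forall i, tnth v i = minn (tnth w i) (prefix_max v i).+1) ->
  (forall i, tnth v' i = minn (tnth w i) (prefix_max v' i).+1) ->
  v = v'.
Proof.
move=> vE v'E; apply: eq_from_tnth => i.
(* Strong induction on the position: [prefix_max] at [i] sees only earlier letters. *)
have [k le_ik] := ubnP (i : nat).
elim: k => // k IHk in i le_ik *.
rewrite vE v'E; congr (minn _ _.+1); apply: eq_bigr => j lt_ji.
exact/IHk/(leq_trans lt_ji).
Qed.

Lemma RG_interval_inj (m n : nat) (w v v' : n.-tupleprod nat) :
  is_RG v -> is_RG v' ->
  word_interval v (omega m v) w -> word_interval v' (omega m v') w ->
  v = v'.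
Proof.
move=> vRG v'RG vw v'w.
exact: minn_rec_inj (RG_interval_rec vRG vw) (RG_interval_rec v'RG v'w).
Qed.

Lemma minn_rec_exists (f : nat -> nat) :
  {g : nat -> nat | forall i, g i = minn (f i) (\max_(j < i) g j).+1}.
Proof.
(* [M i] is the maximum of the first [i] values of [g]. Recursing on it instead of on [g] makes the
   recursion structural. *)
pose M := fix M i := if i is i'.+1 then maxn (M i') (minn (f i') (M i').+1)
                     else 0.
exists (fun i => minn (f i) (M i).+1) => i; congr (minn _ _.+1).
by elim: i => [|i IHi]; rewrite ?big_ord0// big_ord_recr/= -IHi.
Qed.

Lemma RG_interval_exists (m n : nat) (w : n.-tupleprod nat) :
  words (segment m) n w -> exists2 v, is_RG v & word_interval v (omega m v) w.
Proof.
(* Past position [n] the word is padded with the default 0; [v] uses only the values of [g] below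
   [n]. *)
move=> wm; have [g gE] := minn_rec_exists (nth 0 w).
pose v : n.-tupleprod nat := [tuple g i | i < n].
have v_max (i : 'I_n) : prefix_max v i = \max_(j < i) g j.
  rewrite (big_ord_widen n g (ltnW (ltn_ord i))).
  by apply: eq_bigr => j _; rewrite tnth_mktuple.
have vE i : tnth v i = minn (tnth w i) (prefix_max v i).+1.
  by rewrite v_max tnth_mktuple gE -tnth_nth.
have vpos : words posint n v.
  move=> i; rewrite /posint/= vE leq_min andbT.
  by have /andP[] := wm i.
exists v; first by split=> // i; rewrite addn1 [leqLHS]vE geq_minr.
split; first by move=> i; have /andP[] := wm i.
apply/andP; split; apply/word_leP => i; first by rewrite vE geq_minl.
(* At a left-to-right maximum the upper bound is [m]. Elsewhere the minimum defining [v_i] is at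
   most [M_i], so it must be [w_i]. *)
rewrite tnth_mktuple is_lrmaxE ?vpos//; case: ltnP => [_ | ].
  by have /andP[] := wm i.
by rewrite vE geq_min ltnn orbF => le_wM; rewrite (minn_idPl (leqW le_wM)).
Qed.

(** Each letter exceeds the earlier maximum by at most one, and positions count from 0. This yields
    the bound [k <= n]. *)
Lemma RG_tnth_le (n : nat) (v : n.-tupleprod nat) (i : 'I_n) :
  is_RG v -> tnth v i <= i.+1.
Proof.
case=> _ vRG; have [k le_ik] := ubnP (i : nat).
elim: k => // k IHk in i le_ik *.
apply: leq_trans (vRG i) _; rewrite addn1 ltnS; apply/bigmax_leqP => j lt_ji.
exact: leq_trans (IHk _ (leq_trans lt_ji le_ik)) lt_ji.
Qed.

Theorem theorem5p1 (m n : nat) :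
  [/\ words (segment m) n =
        \bigcup_(k in [set k | k <= minn m n])
          \bigcup_(v in RG n k) word_interval v (omega m v),
      trivIset [set k | k <= minn m n]
        (fun k => \bigcup_(v in RG n k) word_interval v (omega m v)) &
      forall k, k <= minn m n ->
        trivIset (RG n k) (fun v => word_interval v (omega m v))].
Proof.
split.
- apply/seteqP; split=> [w wm | w [k /= k_le [v [vRG v_max] [wpos]]]].
    have [v vRG vw] := RG_interval_exists wm.
    (* This maximum is at most [n] by restricted growth, and at most [m] because [v <= w]. *)
    exists (\max_(i < n) tnth v i) => /=; last by exists v.
    apply/bigmax_leqP => i _; rewrite leq_min.
    rewrite (leq_trans (RG_tnth_le i vRG) (ltn_ord i)) andbT.
    case: vw => _ /andP[/word_leP le_vw _]; apply: leq_trans (le_vw i) _.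
    by have /andP[] := wm i.
  case/andP=> _ /word_leP le_wo i; apply/andP; split; first exact: wpos.
  apply: leq_trans (le_wo i) _; rewrite tnth_mktuple; case: ifP => // _.
  (* A letter that [omega] keeps is at most the maximum [k] of [v], hence at most [m]. *)
  apply: leq_trans (leq_trans k_le (geq_minl m n)).
  by rewrite -v_max (leq_bigmax (F := tnth v)).
(* A word [w] common to the blocks of [k] and [k'] forces [v = v'], so the maxima [k] and [k']
   agree. *)
- move=> k k' _ _ [w [[v [vRG <-] vw] [v' [v'RG <-] v'w]]].
  by rewrite (RG_interval_inj vRG v'RG vw v'w).
- move=> k _ v v' [vRG _] [v'RG _] [w [vw v'w]].
  exact: RG_interval_inj vRG v'RG vw v'w.
Qed.
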